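(* Let $T$ be a tree of order $n\geq 6$ and let $\mu$ be a Laplacian eigenvalue of $T$ with $\mu\neq 1$. Then $m_T(\mu)\leq \frac{n-3}{2}$. Moreover, equality $m_T(\mu)=\frac{n-3}{2}$ holds if and only if $T\cong T\!\left(\frac{n-1}{2},\frac{n-1}{2}\right)$ and $\mu=\frac{3\pm\sqrt{5}}{2}$. In particular, if equality holds, then $\mu$ is the algebraic connectivity $\mu_2(T)$ of $T$ or its conjugate.
   Context: For a graph $G$ on $n$ vertices, the Laplacian matrix is $L(G)=D(G)-A(G)$, where $D(G)$ is the diagonal matrix of vertex degrees and $A(G)$ the adjacency matrix. Its eigenvalues, the Laplacian eigenvalues, are denoted $0=\mu_1(G)\leq\mu_2(G)\leq\cdots\leq\mu_n(G)$; $\mu_2(G)$ is called the algebraic connectivity. $m_G(\mu)$ denotes the multiplicity of $\mu$ as a Laplacian eigenvalue of $G$. Two Laplacian eigenvalues are conjugates if they are roots of the same irreducible (over $\mathbb{Q}$) factor of the characteristic polynomial of $L(G)$. For integers $1\leq k\leq s$, the spider $T(s,k)$ is the tree obtained from the star $K_{1,s}$ by extending $k$ of its $s$ rays (edges from the center) by one extra edge each (so each of these $k$ rays becomes a path of length $2$ from the center); it has $s+k+1$ vertices. *)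

(* Defs.v *)
From HB Require Import structures.
From mathcomp Require Import all_boot all_order all_algebra.
From mathcomp Require Import reals.
Set Implicit Arguments. Unset Strict Implicit. Unset Printing Implicit Defensive.
Import Order.TTheory GRing.Theory Num.Theory.
Local Open Scope ring_scope.

Definition simple_graph (n : nat) (adj : rel 'I_n) : Prop :=
  (forall x y, adj x y = adj y x) /\ (forall x, ~~ adj x x).

Definition n_edges (n : nat) (adj : rel 'I_n) : nat :=
  #|[set p : 'I_n * 'I_n | (p.1 < p.2)%N && adj p.1 p.2]|.

Definition is_tree (n : nat) (adj : rel 'I_n) : Prop :=
  [/\ simple_graph adj, (forall x y, connect adj x y) & n_edges adj = n.-1].

Definition degree (n : nat) (adj : rel 'I_n) (i : 'I_n) : nat :=
  #|[set k | adj i k]|.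

Definition laplacian (R : pzRingType) (n : nat) (adj : rel 'I_n) : 'M[R]_n :=
  \matrix_(i, j) (if i == j then (degree adj i)%:R
                  else if adj i j then -1 else 0).

(* multiplicity of mu as a Laplacian eigenvalue (dimension of eigenspace;
   equal to algebraic multiplicity since L is symmetric) *)
Definition lap_mult (R : fieldType) (n : nat) (adj : rel 'I_n) (mu : R) : nat :=
  \rank (eigenspace (laplacian R adj) mu).

(* the spider T(s,k) on vertices 0..s+k: 0 = center, 1..s = neighbours of
   the center, vertex s+i (1 <= i <= k) is a pendant vertex attached to i. *)
Definition spider_adj0 (s k : nat) (u v : nat) : bool :=
  ((u == 0%N) && (1 <= v <= s)%N) || ((1 <= u <= k)%N && (v == u + s)%N).
Definition spider_adj (s k : nat) : rel nat :=
  fun u v => spider_adj0 s k u v || spider_adj0 s k v u.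

Definition iso_spider (n : nat) (adj : rel 'I_n) (s k : nat) : Prop :=
  [/\ (1 <= k <= s)%N, n = (s + k + 1)%N &
   exists f : 'I_n -> 'I_n, bijective f /\
     forall x y, adj x y = spider_adj s k (f x) (f y)].

Definition lap_spectrum (R : realType) (n : nat) (adj : rel 'I_n) (s : seq R) : Prop :=
  sorted <=%R s /\ char_poly (laplacian R adj) = \prod_(x <- s) ('X - x%:P).

Definition lap_conjugates (R : realType) (n : nat) (adj : rel 'I_n) (a b : R) : Prop :=
  exists p : {poly rat}, [/\ irreducible_poly p, p %| char_poly (laplacian rat adj),
     root (map_poly ratr p) a & root (map_poly ratr p) b].

(* Main.v *)
(* Write [core] for the set of non-leaves and Q for the set of vertices adjacent
   to a leaf.  For [mu != 1] the value of an eigenvector at a leaf is determined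
   by its value at the neighbour, and an eigenvector vanishing at a vertex and at
   all but one of its neighbours also vanishes at the last one; so the
   multiplicity m is at most the size of any set of vertices on which the
   vanishing of an eigenvector propagates to the whole tree.  Such sets are Q
   minus a vertex (unless the tree is a star), the core minus two vertices if the
   core contains a path on 3 vertices, and the core minus three vertices if it
   contains a path on 4 vertices.  As 2|Q| <= n, the first bound shows that
   2m >= n - 3 leaves only the cases core = Q, excluded by the second bound, and
   core = Q + w with every vertex of Q carrying one leaf, where the third bound
   forces all of Q to be adjacent to w: the tree is the spider T(q, q).
   On the spider, an eigenvector is determined by its value at the centre unless
   mu^2 - 3 mu + 1 = 0.  Its other eigenvalues are 0, which is simple, and the
   roots of x^2 - (q + 3) x + 2 q + 1, which exceed 1. *)

Require Import Defs.
From HB Require Import structures.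
From mathcomp Require Import all_boot all_order all_algebra.
From mathcomp Require Import reals.
From mathcomp Require Import spectral complex zify ring lra.
Set Implicit Arguments. Unset Strict Implicit. Unset Printing Implicit Defensive.
Import Order.TTheory GRing.Theory Num.Theory.
Local Open Scope ring_scope.

(** * Rooted trees given by a parent map and a depth *)

(** The last clause, that every edge joins a vertex to its parent, expresses acyclicity; [par r] and
    [d r] are left free. *)
Definition rooted_at {n : nat} (adj : rel 'I_n) (r : 'I_n)
    (par : 'I_n -> 'I_n) (d : 'I_n -> nat) : Prop :=
  [/\ forall u, u != r -> adj u (par u),
      forall u, u != r -> d u = (d (par u)).+1
    & forall x y, adj x y -> (x != r /\ y = par x) \/ (y != r /\ x = par y)].

(** Take for [d u] the length of a shortest walk from [r] to [u]; the last vertex but one of such a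
    walk serves as parent. *)
Lemma connected_parent (n : nat) (adj : rel 'I_n) (r : 'I_n) :
  (forall x y, adj x y = adj y x) -> (forall x y, connect adj x y) ->
  exists (par : 'I_n -> 'I_n) (d : 'I_n -> nat),
    forall u, u != r -> adj u (par u) /\ d u = (d (par u)).+1.
Proof.
move=> sym con.
pose P u k := [exists t : k.-tuple 'I_n, path adj r t && (last r t == u)].
have exP u : exists k, P u k.
  have /connectP [p pth ->] := con r u.
  by exists (size p); apply/existsP; exists (in_tuple p); rewrite pth eqxx.
pose d u := ex_minn (exP u).
have par_ex u : u != r -> exists v, adj u v && (d u == (d v).+1).
  move=> ur; rewrite {1}/d; case: ex_minnP => k /existsP [t /andP [pth lst]] kmin.
  case: k t pth lst kmin => [|k] t.
    by rewrite tuple0 /= => _ /eqP ru; rewrite -ru eqxx in ur.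
  case/tupleP: t => a t; rewrite /= => pth lst kmin.
  move: pth lst; rewrite -/(path adj r (a :: t)) lastI rcons_path.
  move=> /andP [pth lnk] /eqP uE; rewrite uE in lnk.
  set v := last r _ in lnk.
  have sz : size (belast a t) = k by rewrite size_belast size_tuple.
  have dv : (d v <= k)%N.
    rewrite /d; case: ex_minnP => j _ jmin; apply: jmin; rewrite -sz.
    by apply/existsP; exists (in_tuple (belast a t)); rewrite pth /= /v.
  have ukv : (k.+1 <= (d v).+1)%N.
    apply: kmin; rewrite /d; case: ex_minnP => j /existsP [s /andP [ps /eqP ls]] _.
    apply/existsP; exists [tuple of rcons s u] => /=.
    by rewrite rcons_path ps ls last_rcons eqxx lnk.
  exists v; rewrite sym lnk /=; move: dv ukv; rewrite /d; case: ex_minnP => j _ _; lia.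
pose par u := odflt r [pick v | adj u v && (d u == (d v).+1)].
exists par, d => u ur; rewrite /par; case: pickP => [v /andP [-> /eqP //]|no].
by have [v] := par_ex u ur; rewrite no.
Qed.

(* A connected graph has an edge from each non-root vertex to its parent; with
   only n - 1 edges available, there are no others. *)
Lemma tree_rooted (n : nat) (adj : rel 'I_n) (r : 'I_n) :
  is_tree adj -> exists par d, rooted_at adj r par d.
Proof.
move=> [[sym irr] con ne].
have [par [d pd]] := @connected_parent n adj r sym con.
exists par, d; split; [by move=> u /pd[] | by move=> u /pd[] | ].
pose phi (u : 'I_n) := if (u < par u)%N then (u, par u) else (par u, u).
pose E := [set p : 'I_n * 'I_n | (p.1 < p.2)%N && adj p.1 p.2].
have sub : phi @: [set~ r] \subset E.
  apply/subsetP => p /imsetP [u]; rewrite in_setC1 => ur {p}->.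
  have [au du] := pd u ur; rewrite /phi; case: (ltngtP u (par u)) => uv; rewrite inE /=.
  - by rewrite uv.
  - by rewrite uv sym.
  - by have e : u = par u by [apply: val_inj]; move: (irr u); rewrite {2}e au.
have inj : {in [set~ r] &, injective phi}.
  (* Two distinct vertices giving the same edge would be parents of each other, against the
     depths. *)
  move=> u v; rewrite !in_setC1 => ur vr.
  have [_ du] := pd u ur; have [_ dv] := pd v vr.
  rewrite /phi; case: ifP => _; case: ifP => _ [] // e1 e2.
  - by move: du dv; rewrite e2 -e1; lia.
  - by move: du dv; rewrite e1 -e2; lia.
have /eqP eqE : phi @: [set~ r] == E.
  rewrite eqEcard sub /= card_in_imset // cardsC1 card_ord.
  by rewrite -[#|E|]/(n_edges adj) ne.
have key (x y : 'I_n) : (x < y)%N -> adj x y ->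
    (x != r /\ y = par x) \/ (y != r /\ x = par y).
  move=> xy a; have : (x, y) \in E by rewrite inE /= xy a.
  rewrite -eqE => /imsetP [u]; rewrite in_setC1 /phi => ur.
  by case: ifP => _ [-> ->]; [left | right].
move=> x y a; case: (ltngtP x y) => xy.
- exact: key.
- by case: (key y x xy); rewrite 1?sym // => h; [right | left].
- by have e : x = y by [apply: val_inj]; move: (irr x); rewrite {2}e a.
Qed.

(** Depths are bounded, so one may induct from the deepest vertices towards the root. *)
Lemma card_max_induction (n : nat) (d : 'I_n -> nat) (P : 'I_n -> Prop) :
  (forall u, (forall v, (d u < d v)%N -> P v) -> P u) -> forall u, P u.
Proof.
move=> step u; pose B := (\max_v d v)%N.
have dB v : (d v <= B)%N by exact: leq_bigmax.
have [k] := ubnP (B - d u); elim: k u => // k IH u Hk.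
by apply: step => v uv; apply: IH; have := dB v; have := dB u; lia.
Qed.

(** Climbing along parents from [z] meets an ancestor exactly two levels below the root. *)
Lemma rooted_step (n : nat) (adj : rel 'I_n) r par d (z : 'I_n) :
  rooted_at adj r par d -> z != r -> par z != r ->
  exists z', [/\ z' != r, par z' != r & par (par z') = r].
Proof.
move=> [_ dp _]; have [k] := ubnP (d z); elim: k z => // k IH z Hk zr pr.
have [ppr | ppr] := eqVneq (par (par z)) r; first by exists z.
by apply: (IH (par z)) => //; move: Hk; rewrite (dp z).
Qed.

(** * Eigenvector equations and coordinates that determine an eigenvector *)

Section EigenvectorForcing.

Variables (R : fieldType) (n : nat) (adj : rel 'I_n).

Definition lap_eigvec (mu : R) (x : 'I_n -> R) : Prop :=
  forall u, (degree adj u)%:R * x u - \sum_(v | adj u v) x v = mu * x u.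

Lemma mul_laplacian (x : 'rV[R]_n) (u : 'I_n) : simple_graph adj ->
  (x *m laplacian R adj) 0 u =
  (degree adj u)%:R * x 0 u - \sum_(v | adj u v) x 0 v.
Proof.
move=> [sym irr]; rewrite mxE (bigD1 u) //= mxE eqxx mulrC; congr (_ + _).
rewrite -sumrN [RHS]big_mkcond [RHS](bigD1 u) //= (negbTE (irr u)) add0r.
apply: eq_bigr => v vu; rewrite mxE (negbTE vu) sym.
by case: (adj u v); rewrite ?mulrN1 ?mulr0.
Qed.

Lemma lap_eigvecP (mu : R) (x : 'rV[R]_n) : simple_graph adj ->
  x *m laplacian R adj = mu *: x <-> lap_eigvec mu (x 0).
Proof.
move=> sg; split=> [e u | e].
  by rewrite -mul_laplacian // e mxE.
by apply/rowP => u; rewrite mul_laplacian // e mxE.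
Qed.

(** If zeros on [S] propagate everywhere, restriction to [S], with matrix [P], is injective on the
    eigenspace. *)
Lemma lap_mult_le (mu : R) (S : {set 'I_n}) : simple_graph adj ->
  (forall x, lap_eigvec mu x -> {in S, forall u, x u = 0} -> forall u, x u = 0) ->
  (lap_mult adj mu <= #|S|)%N.
Proof.
move=> sg forc.
pose P : 'M[R]_(n, #|S|) := \matrix_(i, j) (i == enum_val j)%:R.
set E := eigenspace (laplacian R adj) mu.
have -> : lap_mult adj mu = \rank (E *m P); last exact: rank_leq_col.
rewrite -[LHS](mxrank_mul_ker E P).
suff -> : (E :&: kermx P)%MS = 0 by rewrite mxrank0 addn0.
apply/eqP; rewrite -submx0; apply/rV_subP => x.
rewrite sub_capmx => /andP [/eigenspaceP xE /sub_kermxP xP].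
suff -> : x = 0 by exact: sub0mx.
apply/rowP => u; rewrite [RHS]mxE; apply: (forc (x 0)).
  exact/lap_eigvecP.
move=> v vS; have := congr1 (fun A : 'rV_ _ => A 0 (enum_rank_in vS v)) xP.
rewrite !mxE (bigD1 v) //= mxE enum_rankK_in // eqxx mulr1 big1 ?addr0 // => i iv.
by rewrite mxE enum_rankK_in // (negbTE iv) mulr0.
Qed.

(** [C] selects the coordinates [p s], so [B *m C] is the identity and the given eigenvectors, the
    rows of [B], are independent. *)
Lemma lap_mult_ge (mu : R) (k : nat) (x : 'I_k -> 'I_n -> R) (p : 'I_k -> 'I_n) :
  simple_graph adj -> (forall t, lap_eigvec mu (x t)) ->
  (forall t s, x t (p s) = (t == s)%:R) -> (k <= lap_mult adj mu)%N.
Proof.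
move=> sg xE xp.
pose B : 'M[R]_(k, n) := \matrix_(t, u) x t u.
pose C : 'M[R]_(n, k) := \matrix_(u, s) (u == p s)%:R.
have BC : B *m C = 1%:M.
  apply/matrixP => t s; rewrite !mxE (bigD1 (p s)) //= !mxE eqxx mulr1 xp.
  by rewrite big1 ?addr0 // => u up; rewrite !mxE (negbTE up) mulr0.
have <- : \rank B = k.
  by apply/eqP; rewrite eqn_leq rank_leq_row /= -{1}(mxrank1 R k) -BC mxrankM_maxl.
apply: mxrankS; apply/row_subP => t; apply/eigenspaceP/lap_eigvecP => // u.
have := xE t u; rewrite !mxE => <-; congr (_ - _).
by apply: eq_bigr => v _; rewrite !mxE.
Qed.

(** When [x u = 0], the equation at [u] says that the values at its neighbours sum to zero. *)
Lemma forced_zero (mu : R) x u w : lap_eigvec mu x -> x u = 0 -> adj u w ->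
  (forall v, adj u v -> v != w -> x v = 0) -> x w = 0.
Proof.
move=> xE xu uw z; have := xE u; rewrite xu !mulr0 sub0r (bigD1 w) //= big1.
  by rewrite addr0 => /eqP; rewrite oppr_eq0 => /eqP.
by move=> v /andP [uv vw]; apply: z.
Qed.

End EigenvectorForcing.

(** * Leaves and inner vertices *)

Definition leaf {n : nat} (adj : rel 'I_n) (u : 'I_n) : bool := degree adj u == 1%N.

Lemma leaf_uniq n (adj : rel 'I_n) u v w :
  leaf adj u -> adj u v -> adj u w -> v = w.
Proof.
by case/cards1P => a e uv uw; have : v \in [set a] by [rewrite -e inE];
  have : w \in [set a] by [rewrite -e inE]; rewrite !inE => /eqP -> /eqP ->.
Qed.

Lemma nonleaf_other n (adj : rel 'I_n) u v : ~~ leaf adj u -> adj u v ->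
  exists2 w, adj u w & w != v.
Proof.
move=> nl uv; case: (pickP (fun w => adj u w && (w != v))) => [w /andP[]|no].
  by exists w.
case/negP: nl; apply/cards1P; exists v; apply/setP => w; rewrite !inE.
by apply/idP/eqP => [uw|->//]; have := no w; rewrite uw /= => /negbFE /eqP.
Qed.

(** At a leaf the equation reads (1 - mu) x u = x v; this is how [mu != 1] enters the proof. *)
Lemma leaf_zero (R : fieldType) n (adj : rel 'I_n) (mu : R) x u v : mu != 1 ->
  lap_eigvec adj mu x -> leaf adj u -> adj u v -> x v = 0 -> x u = 0.
Proof.
move=> mu1 xE lu uv xv; have := xE u; rewrite (eqP lu) mul1r big1.
  rewrite subr0 => e; apply/eqP; have : (1 - mu) * x u = 0 by rewrite mulrBl -e mul1r subrr.
  by move/eqP; rewrite mulf_eq0 subr_eq0 eq_sym (negbTE mu1).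
by move=> w uw; rewrite (leaf_uniq lu uw uv).
Qed.

(** The parent and the child of [u] are distinct neighbours, as their depths differ by two. *)
Lemma rooted_nonleaf n (adj : rel 'I_n) r par d u v :
  simple_graph adj -> rooted_at adj r par d ->
  u != r -> v != r -> par v = u -> ~~ leaf adj u.
Proof.
move=> [sym irr] [pa dp _] ur vr vu; apply/negP => lu.
have uv : adj u v by rewrite sym -vu; exact: pa.
have := leaf_uniq lu uv (pa u ur).
by move=> e; have := dp u ur; have := dp v vr; rewrite vu -e; lia.
Qed.

Lemma rooted_child n (adj : rel 'I_n) r par d u :
  rooted_at adj r par d -> u != r -> ~~ leaf adj u ->
  exists c, [/\ c != r, par c = u & adj u c].
Proof.
move=> [pa dp ed] ur nl; have [c uc cp] := nonleaf_other nl (pa u ur).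
by case: (ed _ _ uc) => [[_ e]|[cr e]]; [rewrite e eqxx in cp | exists c].
Qed.

Lemma rooted_nbr n (adj : rel 'I_n) r par d u v :
  rooted_at adj r par d -> adj u v -> (u == r) || (v != par u) ->
  v != r /\ par v = u.
Proof.
move=> [_ _ ed] uv; case: (ed _ _ uv) => [[ur ->]|[vr ->] //].
by rewrite (negbTE ur) eqxx.
Qed.

(** * Upper bounds for the multiplicity in a tree *)

Section TreeMultiplicity.

Variables (R : fieldType) (n : nat) (adj : rel 'I_n) (mu : R).
Hypotheses (tree : is_tree adj) (n_gt2 : (2 < n)%N) (mu_neq1 : mu != 1).

Let sg : simple_graph adj. Proof. by case: tree. Qed.
Let sym : forall x y, adj x y = adj y x. Proof. by case: sg. Qed.
Let irr : forall x, ~~ adj x x. Proof. by case: sg. Qed.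

Lemma exists_nonleaf : exists r, ~~ leaf adj r.
Proof.
pose r : 'I_n := Ordinal (ltnW (ltnW n_gt2)).
have [lr | ] := boolP (leaf adj r); last by exists r.
have [par [d rt]] := tree_rooted r tree; have [pa dp ed] := rt.
(* If [a] and [b] were both children of the leaf [r], it would have two neighbours. *)
have [z zr pzr] : exists2 z, z != r & par z != r.
  pose a : 'I_n := Ordinal (ltnW n_gt2); pose b : 'I_n := Ordinal n_gt2.
  have [pra | ?] := eqVneq (par a) r; last by exists a.
  exists b => //; apply/eqP => prb.
  have ra : adj r a by rewrite sym -[X in adj _ X]pra; exact: pa.
  have rb : adj r b by rewrite sym -[X in adj _ X]prb; exact: pa.
  by have := leaf_uniq lr ra rb => /(congr1 val).
have [z' [z'r pz'r _]] := rooted_step rt zr pzr.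
by exists (par z'); exact: (rooted_nonleaf (v:=z') sg rt).
Qed.

Lemma leaf_nbr u v : leaf adj u -> adj u v -> ~~ leaf adj v.
Proof.
move=> lu uv; have [r nlr] := exists_nonleaf.
have [par [d rt]] := tree_rooted r tree; have [pa dp ed] := rt.
have ur : u != r by apply: contraNneq nlr => <-.
have -> : v = par u by apply: leaf_uniq lu uv (pa u ur).
have [-> // | pr] := eqVneq (par u) r.
exact: (rooted_nonleaf (v:=u) sg rt).
Qed.

Definition leaves : {set 'I_n} := [set u | leaf adj u].
Definition quasi_pendants : {set 'I_n} :=
  [set v | ~~ leaf adj v && [exists l, leaf adj l && adj v l]].

Lemma leaf_quasi_pendant l v : leaf adj l -> adj l v -> v \in quasi_pendants.
Proof.
move=> ll lv; rewrite inE (leaf_nbr ll lv) /=.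
by apply/existsP; exists l; rewrite ll sym.
Qed.

Lemma quasi_pendant_sub : quasi_pendants \subset ~: leaves.
Proof. by apply/subsetP => v; rewrite !inE => /andP []. Qed.

Lemma exists_leaf_nbr : exists2 f : 'I_n -> 'I_n,
  {in quasi_pendants, forall v, leaf adj (f v) && adj v (f v)} & 
  {in quasi_pendants &, injective f}.
Proof.
exists (fun v => odflt v [pick l | leaf adj l && adj v l]).
  move=> v; rewrite inE => /andP [_ /existsP [l lP]].
  by case: pickP => [//|/(_ l)]; rewrite lP.
move=> u v; rewrite !inE => /andP [_ /existsP [l lP]] /andP [_ /existsP [k kP]].
case: pickP => [l' /andP [ll ul] | /(_ l)]; last by rewrite lP.
case: pickP => [k' /andP [lk vk] | /(_ k)] /=; last by rewrite kP.
by move=> e; move: vk; rewrite -e sym => vk; apply: leaf_uniq ll _ vk; rewrite sym.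
Qed.

Lemma card_quasi_pendants : (#|quasi_pendants| <= #|leaves|)%N.
Proof.
have [f fP inj] := exists_leaf_nbr.
rewrite -(card_in_imset inj); apply: subset_leq_card; apply/subsetP => l.
by case/imsetP => v vQ ->; rewrite inE; case/andP: (fP v vQ).
Qed.

(** A vertex of maximal depth is a leaf, and its parent is the vertex sought. *)
Lemma exists_quasi_pendant : exists v, v \in quasi_pendants.
Proof.
have [r nlr] := exists_nonleaf.
have [par [d rt]] := tree_rooted r tree; have [pa dp ed] := rt.
case: (arg_maxnP d (erefl true : predT r)) => u _ umax.
have lu : leaf adj u.
  have [ur | ur] := eqVneq u r; last first.
    apply: contraT => nl; have [c [cr cu _]] := rooted_child rt ur nl.
    by have := umax c isT; rewrite /geq /= (dp c cr) cu ltnn.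
  have [z zr] : exists z, z != r.
    pose a : 'I_n := Ordinal (ltnW n_gt2).
    by have [e | ?] := eqVneq a r; [exists (Ordinal n_gt2); rewrite -e | exists a].
  have [z' [z'r pz']] : exists z', z' != r /\ par z' = r.
    have [? | pz] := eqVneq (par z) r; first by exists z.
    by have [z' [_ p e]] := rooted_step rt zr pz; exists (par z').
  by have := umax z' isT; rewrite /geq /= (dp z' z'r) pz' ur ltnn.
have ur : u != r by apply: contraNneq nlr => <-.
by exists (par u); apply: leaf_quasi_pendant lu (pa u ur).
Qed.

Lemma zero_on_nonleaves x : lap_eigvec adj mu x ->
  (forall v, ~~ leaf adj v -> x v = 0) -> forall u, x u = 0.
Proof.
move=> xE z u; have [lu | ?] := boolP (leaf adj u); last exact: z.
have /card_gt0P [v] : (0 < degree adj u)%N by rewrite (eqP lu).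
rewrite inE => uv; apply: (leaf_zero mu_neq1 xE lu uv _).
by apply: z; apply: leaf_nbr lu uv.
Qed.

(** Leaves at [u] vanish together with [u], so only non-leaf neighbours need control. *)
Lemma forced_zero_core x u w : lap_eigvec adj mu x -> x u = 0 -> adj u w ->
  (forall v, ~~ leaf adj v -> adj u v -> v != w -> x v = 0) -> x w = 0.
Proof.
move=> xE xu uw z; apply: (forced_zero xE xu uw _) => v uv vw.
have [lv | nlv] := boolP (leaf adj v); last exact: z.
by apply: (leaf_zero mu_neq1 xE lv _ xu); rewrite sym.
Qed.

Lemma mult_star v0 : (forall v, ~~ leaf adj v -> v = v0) ->
  (lap_mult adj mu <= 1)%N.
Proof.
move=> only; rewrite -(cards1 v0); apply: lap_mult_le => // x xE x0.
by apply: zero_on_nonleaves => // v /only ->; apply: x0; rewrite inE.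
Qed.

(** Root at [v0] and let [x] vanish on the other quasi-pendants: zeros climb from the deepest
    vertices, reach [v0] through [c0], then the leaves at [v0]. *)
Lemma mult_lt_quasi_pendants v0 c0 : v0 \in quasi_pendants ->
  adj v0 c0 -> ~~ leaf adj c0 -> (lap_mult adj mu < #|quasi_pendants|)%N.
Proof.
move=> v0Q vc nlc; rewrite (cardsD1 v0) v0Q ltnS; apply: lap_mult_le => // x xE x0.
have [par [d rt]] := tree_rooted v0 tree; have [pa dp ed] := rt.
(* Leaves attached to [v0] are excepted, since [v0] is not yet known to vanish. *)
have off u : u != v0 -> ~~ (leaf adj u && adj v0 u) -> x u = 0.
  elim/(card_max_induction (d:=d)): u => u IH uv0.
  have [lu /= nvu | nlu _] := boolP (leaf adj u).
    have pv0 : par u != v0 by apply: contraNneq nvu => <-; rewrite sym pa.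
    apply: (leaf_zero mu_neq1 xE lu (pa u uv0) _); apply: x0.
    by rewrite in_setD1 pv0 (leaf_quasi_pendant lu) ?pa.
  have [c [cv0 pc uc]] := rooted_child rt uv0 nlu.
  have far y : y != v0 -> par y != v0 -> ~~ (leaf adj y && adj v0 y).
    move=> yv py; apply/negP => /andP [_ /ed [[]|[_ e]]]; first by rewrite eqxx.
    by rewrite e eqxx in py.
  (* The equation at the child [c] forces the value at [u]: [c] and its children are deeper, hence
     already zero. *)
  apply: (forced_zero xE (IH c _ cv0 _) _ _); first by rewrite (dp c cv0) pc.
  - by apply: far; rewrite ?pc.
  - by rewrite sym.
  - move=> v cv vu; have [] := rooted_nbr rt cv; rewrite ?pc ?vu ?orbT //.
    move=> vv0 pv; apply: IH => //; first by rewrite (dp v vv0) pv (dp c cv0) pc; lia.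
    by apply: far; rewrite ?pv.
have cv0 : c0 != v0 by apply: contraNneq (irr v0) => e; rewrite -{2}e.
have [] := rooted_nbr rt vc; rewrite ?eqxx // => _ pc.
(* [c0] and its children vanish, so the equation at [c0] forces the value at [v0]. *)
have xv0 : x v0 = 0.
  apply: (forced_zero xE (off c0 cv0 _) _ _); first by rewrite (negbTE nlc).
    by rewrite sym.
  move=> y cy yv; have [] := rooted_nbr rt cy; rewrite ?pc ?yv ?orbT //.
  move=> _ py; apply: off => //; apply/negP => /andP [_ /ed [[]|[_ e]]]; first by rewrite eqxx.
  by rewrite e py eqxx in cv0.
apply: zero_on_nonleaves => // v nlv; have [-> // | vv0] := eqVneq v v0.
by apply: off => //; rewrite (negbTE nlv).
Qed.

(** Let [x] vanish on the core outside [v1] and [v2]. The equation at [v0] kills [v1], as [v2] is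
    not adjacent to [v0] in a tree; the equation at [v1] then kills [v2]. *)
Lemma mult_path3 v0 v1 v2 : ~~ leaf adj v0 -> ~~ leaf adj v1 -> ~~ leaf adj v2 ->
  adj v0 v1 -> adj v1 v2 -> v0 != v2 -> (lap_mult adj mu + 2 <= #|~: leaves|)%N.
Proof.
move=> l0 l1 l2 a1 a2 n02.
have [par [d rt]] := tree_rooted v0 tree; have [pa dp ed] := rt.
have [v10 p1] : v1 != v0 /\ par v1 = v0.
  by apply: (rooted_nbr rt a1 _); rewrite eqxx.
have [v20 p2] : v2 != v0 /\ par v2 = v1.
  by apply: (rooted_nbr rt a2 _); rewrite p1 [v2 == _]eq_sym n02 orbT.
have n12 : v1 != v2 by apply: contraNneq (irr v1) => e; rewrite {2}e.
rewrite (cardsD1 v1) (cardsD1 v2) !inE l1 l2 eq_sym n12 /= addnC addnA leq_add2l.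
apply: lap_mult_le => // x xE x0.
have z v : ~~ leaf adj v -> v != v1 -> v != v2 -> x v = 0.
  by move=> lv vv1 vv2; apply: x0; rewrite !inE vv2 vv1 lv.
have x1 : x v1 = 0.
  apply: (forced_zero_core xE (z v0 _ _ _) a1 _) => //; first by rewrite eq_sym.
  move=> v lv a vv1; apply: z => //; apply: contraNneq v10 => e.
  have [] := rooted_nbr rt a; first by rewrite eqxx.
  by rewrite e p2 => _ ->.
have x2 : x v2 = 0.
  apply: (forced_zero_core xE x1 a2 _) => // v lv a vv2; apply: z => //.
  by apply: contraNneq (irr v1) => e; rewrite -{2}e.
apply: zero_on_nonleaves => // v lv; have [-> // | vv1] := eqVneq v v1.
by have [-> // | vv2] := eqVneq v v2; apply: z.
Qed.

(** One step further than for three vertices: the equations at [v0], [v1], [v2] kill [v1], [v2],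
    [v3] in turn. *)
Lemma mult_path4 v0 v1 v2 v3 :
  ~~ leaf adj v0 -> ~~ leaf adj v1 -> ~~ leaf adj v2 -> ~~ leaf adj v3 ->
  adj v0 v1 -> adj v1 v2 -> adj v2 v3 -> v0 != v2 -> v1 != v3 ->
  (lap_mult adj mu + 3 <= #|~: leaves|)%N.
Proof.
move=> l0 l1 l2 l3 a1 a2 a3 n02 n13.
have [par [d rt]] := tree_rooted v0 tree; have [pa dp ed] := rt.
have [v10 p1] : v1 != v0 /\ par v1 = v0.
  by apply: (rooted_nbr rt a1 _); rewrite eqxx.
have [v20 p2] : v2 != v0 /\ par v2 = v1.
  by apply: (rooted_nbr rt a2 _); rewrite p1 [v2 == _]eq_sym n02 orbT.
have [v30 p3] : v3 != v0 /\ par v3 = v2.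
  by apply: (rooted_nbr rt a3 _); rewrite p2 [v3 == _]eq_sym n13 orbT.
have n12 : v1 != v2 by apply: contraNneq (irr v1) => e; rewrite {2}e.
have n23 : v2 != v3 by apply: contraNneq (irr v2) => e; rewrite {2}e.
rewrite (cardsD1 v1) (cardsD1 v2) (cardsD1 v3) !inE l1 l2 l3.
rewrite ![_ == v1]eq_sym n12 n13 [v3 == _]eq_sym n23 /= addnC !addnA leq_add2l.
apply: lap_mult_le => // x xE x0.
have z v : ~~ leaf adj v -> v != v1 -> v != v2 -> v != v3 -> x v = 0.
  by move=> lv vv1 vv2 vv3; apply: x0; rewrite !inE vv3 vv2 vv1 lv.
have kid u v : adj u v -> (u == v0) || (v != par u) -> par v = u.
  by move=> a h; have [] := rooted_nbr rt a h.
have x1 : x v1 = 0.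
  apply: (forced_zero_core xE (z v0 _ _ _ _) a1 _); rewrite 1?eq_sym // => v lv a vv1.
  have pv : par v = v0 by apply: kid a _; rewrite eqxx.
  by apply: z => //; [apply: contraNneq v10 | apply: contraNneq v20] => e; rewrite -pv e ?p2 ?p3.
have x2 : x v2 = 0.
  apply: (forced_zero_core xE x1 a2 _) => v lv a vv2.
  have [-> | vv0] := eqVneq v v0; first by apply: z; rewrite // eq_sym.
  have pv : par v = v1 by apply: kid a _; rewrite p1 vv0 orbT.
  apply: z => //; first by apply: contraNneq (irr v1) => e; rewrite -{2}e.
  by apply: contraNneq n12 => e; rewrite -pv e p3.
have x3 : x v3 = 0.
  apply: (forced_zero_core xE x2 a3 _) => v lv a vv3.
  have [-> // | vv1] := eqVneq v v1.
  by apply: z => //; apply: contraNneq (irr v2) => e; rewrite -{2}e.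
apply: zero_on_nonleaves => // v lv; have [-> // | vv1] := eqVneq v v1.
have [-> // | vv2] := eqVneq v v2; have [-> // | vv3] := eqVneq v v3; exact: z.
Qed.

End TreeMultiplicity.

(** * Structure of trees with large multiplicity *)

Lemma rooted_par_nonleaf n (adj : rel 'I_n) r par d u :
  simple_graph adj -> rooted_at adj r par d -> ~~ leaf adj r ->
  u != r -> ~~ leaf adj (par u).
Proof.
move=> sg rt nlr ur; have [-> // | pr] := eqVneq (par u) r.
exact: (rooted_nonleaf (v := u) sg rt).
Qed.

Section LargeMultiplicity.

Variables (R : fieldType) (n : nat) (adj : rel 'I_n) (mu : R).
Hypotheses (tree : is_tree adj) (n_gt5 : (5 < n)%N) (mu_neq1 : mu != 1).

Let sg : simple_graph adj. Proof. by case: tree. Qed.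
Let sym : forall x y, adj x y = adj y x. Proof. by case: sg. Qed.
Let n_gt2 : (2 < n)%N. Proof. by lia. Qed.

(** If a quasi-pendant [v0] has a non-leaf neighbour, the strict bound applies. Otherwise the tree
    is a star: any further non-leaf would be, or descend from, a non-leaf neighbour of [v0]. *)
Lemma mult_bound :
  (lap_mult adj mu <= 1)%N \/ (lap_mult adj mu < #|quasi_pendants adj|)%N.
Proof.
have [v0 v0Q] := exists_quasi_pendant tree n_gt2.
have nl0 : ~~ leaf adj v0 by move: v0Q; rewrite inE => /andP [].
case: (pickP (fun c => adj v0 c && ~~ leaf adj c)) => [c /andP [a nl] | no].
  by right; apply: (mult_lt_quasi_pendants tree n_gt2 mu_neq1 v0Q a nl).
left; apply: (@mult_star _ _ _ _ tree n_gt2 mu_neq1 v0) => v nlv.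
apply/eqP/negPn/negP => vv0.
have [par [d rt]] := tree_rooted v0 tree; have [pa dp ed] := rt.
have [e | pv] := eqVneq (par v) v0.
  by have := no v; rewrite nlv -[X in adj X _]e sym pa.
have [z [zr pzr ppz]] := rooted_step rt vv0 pv.
have := no (par z); rewrite (rooted_par_nonleaf sg rt nl0 zr) andbT.
by rewrite -[X in adj X _]ppz sym pa.
Qed.

(** Given non-leaves [r], [z1], [z2], either some [z] lies at depth at least two below [r] and its
    path upwards works, or [r] is adjacent to both. *)
Lemma core_path3 : (2 < #|~: leaves adj|)%N ->
  exists v0 v1 v2, [/\ ~~ leaf adj v0, ~~ leaf adj v1 & ~~ leaf adj v2] /\
    [/\ adj v0 v1, adj v1 v2 & v0 != v2].
Proof.
have [r nlr] := exists_nonleaf tree n_gt2; rewrite (cardsD1 r) !inE nlr ltnS.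
move=> /card_gt1P [z1 [z2 []]]; rewrite !inE => /andP [z1r l1] /andP [z2r l2] z12.
have [par [d rt]] := tree_rooted r tree; have [pa dp ed] := rt.
have up z : z != r -> ~~ leaf adj z -> par z != r ->
  exists v0 v1 v2, [/\ ~~ leaf adj v0, ~~ leaf adj v1 & ~~ leaf adj v2] /\
    [/\ adj v0 v1, adj v1 v2 & v0 != v2].
  move=> zr lz pz; exists z, (par z), (par (par z)).
  split; split; rewrite ?pa //; try exact: (rooted_par_nonleaf sg rt nlr _).
  by apply/eqP => e; move: (dp z zr) (dp _ pz); rewrite -e; lia.
have [p1 | ?] := eqVneq (par z1) r; last exact: (up z1).
have [p2 | ?] := eqVneq (par z2) r; last exact: (up z2).
exists z1, r, z2; split; split=> //; first by rewrite -[X in adj _ X]p1 pa.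
by rewrite sym -[X in adj _ X]p2 pa.
Qed.

Lemma extremal_structure : (n - 3 <= 2 * lap_mult adj mu)%N ->
  exists w, [/\ n = (#|quasi_pendants adj| + #|quasi_pendants adj| + 1)%N,
    lap_mult adj mu = #|quasi_pendants adj|.-1,
    ~: leaves adj = w |: quasi_pendants adj, w \notin quasi_pendants adj
    & {in quasi_pendants adj, forall z, adj w z}].
Proof.
set Q := quasi_pendants adj => big.
(* Here n - 3 >= 3 excludes multiplicity at most 1. *)
have [? | mq] := mult_bound; first by lia.
have cL := cardsC (leaves adj); rewrite card_ord in cL.
have qL := card_quasi_pendants tree; have QI := quasi_pendant_sub adj.
have qI := subset_leq_card QI; rewrite -/Q in mq qL QI qI.
(* With q the size of [Q] and m <= q - 1, the assumption gives n <= 2q + 1, while leaves and core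
   have at least q vertices each; so the core has q or q + 1 vertices. *)
have [eI | nI] := eqVneq #|~: leaves adj| #|Q|.
  have [|v0 [v1 [v2 [[l0 l1 l2] [a1 a2 n02]]]]] := core_path3; first by lia.
  by have := mult_path3 tree n_gt2 mu_neq1 l0 l1 l2 a1 a2 n02; lia.
have /cards1P [w wE] : #|~: leaves adj :\: Q| == 1%N.
  by rewrite cardsD (setIidPr QI); apply/eqP; lia.
have : w \in ~: leaves adj :\: Q by rewrite wE inE.
rewrite in_setD => /andP [wQ wI].
have IE : ~: leaves adj = w |: Q.
  by rewrite -(setID (~: leaves adj) Q) (setIidPr QI) wE setUC.
have nlw : ~~ leaf adj w by move: wI; rewrite !inE.
exists w; split => //; try lia.
move=> z zQ; have nlz : ~~ leaf adj z.
  by have := subsetP QI z zQ; rewrite !inE.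
have zw : z != w by apply: contraNneq wQ => <-.
have [par [d rt]] := tree_rooted w tree; have [pa dp ed] := rt.
have [e | pzw] := eqVneq (par z) w; first by rewrite -[X in adj X _]e sym pa.
(* If [z] is not adjacent to [w], climbing from it gives a non-leaf [z'] at distance two from [w],
   the start of a path on 4 core vertices. *)
have [z' [z'w pz' ppz]] : exists z', [/\ z' != w, par z' != w & ~~ leaf adj z' /\ par (par z') = w].
  have [k] := ubnP (d z); elim: k z {zQ} nlz zw pzw => // k IH y nly yw pyw dy.
  have [e | ppy] := eqVneq (par (par y)) w; first by exists y.
  apply: (IH (par y)) => //; first exact: (rooted_par_nonleaf sg rt nlw yw).
  by move: dy; rewrite (dp y).
case: ppz => nlz' ppz.
have nly : ~~ leaf adj (par z') by exact: (rooted_par_nonleaf sg rt nlw _).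
have a2 : adj (par z') w by rewrite -[X in adj _ X]ppz pa.
(* A second neighbour of [w] is not a leaf because [w] is not in [Q]; it completes the path, and m +
   3 <= q + 1 contradicts m = q - 1. *)
have [y wy ny] : exists2 y, adj w y & y != par z'.
  by apply: (nonleaf_other nlw); rewrite sym.
have nlyy : ~~ leaf adj y.
  by apply/negP => ly; move: wQ; rewrite (leaf_quasi_pendant tree n_gt2 ly) // sym.
have z'pz : z' != w by [].
have nyz : par z' != y by rewrite eq_sym.
have h := mult_path4 tree n_gt2 mu_neq1 nlz' nly nlw nlyy (pa z' z'w) a2 wy z'pz nyz.
by clear - h big mq cL qL qI nI; lia.
Qed.

(* Leaves and quasi-pendant vertices are equinumerous here, so sending a leaf
   to its neighbour is a bijection onto the quasi-pendant vertices. *)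
Lemma extremal_spider : (n - 3 <= 2 * lap_mult adj mu)%N ->
  iso_spider adj n.-1./2 n.-1./2.
Proof.
move=> big; have [w [nE mE IE wQ wadj]] := extremal_structure big.
have qI : {in quasi_pendants adj, forall z, ~~ leaf adj z}.
  by move=> z; rewrite inE => /andP [].
have lQ := leaf_quasi_pendant tree n_gt2.
move: nE mE IE wQ wadj qI lQ; set Q := quasi_pendants adj; set q := #|Q|.
move=> nE mE IE wQ wadj qI lQ.
have -> : n.-1./2 = q by rewrite nE addn1 /= addnn doubleK.
have cL : #|leaves adj| = q.
  have := cardsC (leaves adj); rewrite IE cardsU1 wQ card_ord -/q; lia.
have [par [d rt]] := tree_rooted w tree; have [pa dp ed] := rt.
have nlw : ~~ leaf adj w.
  by have : w \in ~: leaves adj; [rewrite IE setU11 | rewrite !inE].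
have lw l : leaf adj l -> l != w by move=> ll; apply: contraNneq nlw => <-.
have parQ z : z \in Q -> par z = w.
  by move=> zQ; have [] := rooted_nbr rt (wadj z zQ); rewrite ?eqxx.
have plQ l : leaf adj l -> par l \in Q by move=> ll; apply: (lQ l) => //; apply: pa; apply: lw.
have lpar l v : leaf adj l -> adj l v -> v = par l.
  by move=> ll lv; apply: (leaf_uniq ll) => //; apply: pa; apply: lw.
have nonQ u : ~~ leaf adj u -> u != w -> u \in Q.
  move=> nl uw; have : u \in ~: leaves adj by rewrite !inE.
  by rewrite IE !inE (negbTE uw).
have parinj : {in leaves adj &, injective par}.
  apply/imset_injP; rewrite cL; apply/eqP; congr (#|pred_of_set _|).
  apply/setP => v; apply/imsetP/idP => [[l]|vQ].
    by rewrite inE => ll ->; apply: plQ.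
  move: (vQ); rewrite inE => /andP [_ /existsP [l /andP [ll vl]]].
  by exists l; rewrite ?inE //; apply: lpar; rewrite // sym.
pose ix v := index v (enum Q).
have ixlt v : v \in Q -> (ix v < q)%N by rewrite /ix /q cardE index_mem mem_enum.
have ixinj u v : u \in Q -> v \in Q -> ix u = ix v -> u = v.
  by move=> uQ vQ; apply: (index_inj u); rewrite mem_enum.
have npos : (0 < n)%N by lia.
(* The numbering of the spider: [w] is the centre 0, [Q] receives 1 to q, and a leaf the number of
   its neighbour plus q. *)
pose F u := if u == w then 0%N else
  if leaf adj u then ((ix (par u)).+1 + q)%N else (ix u).+1.
have Fw : F w = 0%N by rewrite /F eqxx.
have FQ u : u \in Q -> F u = (ix u).+1.
  by move=> uQ; rewrite /F (negbTE (qI u uQ)); case: eqP wQ => // <-; rewrite uQ.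
have Fl l : leaf adj l -> F l = ((ix (par l)).+1 + q)%N.
  by move=> ll; rewrite /F ll (negbTE (lw l ll)).
have kind u : [\/ u = w, u \in Q | leaf adj u].
  have [-> | uw] := eqVneq u w; first by constructor 1.
  have [? | nl] := boolP (leaf adj u); first by constructor 3.
  by constructor 2; apply: nonQ.
have Flt u : (F u < n)%N.
  case: (kind u) => [-> | uQ | ll]; rewrite ?Fw // ?(FQ _ uQ) ?(Fl _ ll) ?nE.
    by have := ixlt u uQ; lia.
  by have := ixlt _ (plQ u ll); lia.
pose f u : 'I_n := Ordinal (Flt u).
have finj : injective f.
  move=> u v /(congr1 val) /=.
  case: (kind u) => [-> | uQ | lu]; case: (kind v) => [-> | vQ | lv];
    rewrite ?Fw ?(FQ _ uQ) ?(FQ _ vQ) ?(Fl _ lu) ?(Fl _ lv) //.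
  - by case=> e; apply: ixinj.
  - by have := ixlt u uQ; lia.
  - by have := ixlt v vQ; lia.
  - move=> /eqP; rewrite eqn_add2r eqSS => /eqP /(ixinj _ _ (plQ u lu) (plQ v lv)) e.
    by apply: parinj; rewrite ?inE.
(* The one-directional [spider_adj0] matches the parent-child pairs of the tree rooted at [w]. *)
have key u v : spider_adj0 q q (F u) (F v) = (v != w) && (u == par v).
  rewrite /spider_adj0.
  case: (kind v) => [-> | vQ | lv].
  - by rewrite Fw eqxx /=; case: (F u) => [|k]; rewrite ?andbF //= andbF.
  - have vw : v != w by apply: contraNneq wQ => <-.
    rewrite vw parQ // (FQ _ vQ) /=; have hv := ixlt v vQ; rewrite hv andbT.
    have [-> | uw] := eqVneq u w; first by rewrite Fw.
    rewrite /F (negbTE uw); case: ifP => _ /=; lia.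
  - have pQ := plQ v lv; have hv := ixlt _ pQ.
    rewrite (lw v lv) (Fl v lv) /=.
    case: (kind u) => [-> | uQ | lu].
    + rewrite Fw /= orbF; have /negbTE -> : w != par v by apply: contraNneq wQ => ->.
      by lia.
    + rewrite (FQ _ uQ) /= eqn_add2r eqSS ixlt //=.
      apply/eqP/eqP => [e | -> //]; exact/esym/(ixinj _ _ pQ uQ).
    + have hu := ixlt _ (plQ u lu).
      have /negbTE -> : u != par v by apply: contraTneq lu => ->; exact: qI.
      by rewrite (Fl u lu) /=; lia.
split; [by lia | by rewrite nE | ].
exists f; split; first exact: injF_bij.
move=> x y; rewrite /spider_adj !key.
apply/idP/idP => [/ed [[xw ->]|[yw ->]] | /orP [/andP [yw /eqP ->]|/andP [xw /eqP ->]]].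
- by rewrite xw eqxx orbT.
- by rewrite yw eqxx.
- by rewrite sym pa.
- by rewrite pa.
Qed.

End LargeMultiplicity.

(** * Laplacian eigenvectors of the spider T(q, q) *)

Lemma big_spider0 (R : nmodType) (q : nat) (Y : nat -> R) :
  \sum_(v < q + q + 1 | spider_adj q q 0 v) Y v = \sum_(i < q) Y i.+1.
Proof.
rewrite -(big_mkord xpredT (fun i => Y i.+1)) -(big_mkord (spider_adj q q 0)).
rewrite -(big_add1 _ _ 0 q.+1 xpredT).
rewrite [RHS](big_nat_widenl _ 0) // [RHS](big_nat_widen _ _ (q + q + 1)); last by lia.
by apply: eq_bigl => -[|i]; rewrite /spider_adj /spider_adj0 /= ?orbF //; lia.
Qed.

Lemma big_spider_mid (R : nmodType) (q : nat) (Y : nat -> R) (i : nat) :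
  (i < q)%N ->
  \sum_(v < q + q + 1 | spider_adj q q i.+1 v) Y v = Y 0%N + Y (i.+1 + q)%N.
Proof.
move=> iq; have h0 : (0 < q + q + 1)%N by lia.
have hl : (i.+1 + q < q + q + 1)%N by lia.
rewrite (bigD1 (Ordinal h0)) /=; last by rewrite /spider_adj /spider_adj0 /=; lia.
rewrite (bigD1 (Ordinal hl)) /=; last by rewrite /spider_adj /spider_adj0 /=; lia.
rewrite big_pred0 ?addr0 // => -[v hv]; rewrite -!val_eqE /spider_adj /spider_adj0 /=.
by lia.
Qed.

Lemma big_spider_leaf (R : nmodType) (q : nat) (Y : nat -> R) (i : nat) :
  (i < q)%N ->
  \sum_(v < q + q + 1 | spider_adj q q (i.+1 + q) v) Y v = Y i.+1.
Proof.
move=> iq; have hl : (i.+1 < q + q + 1)%N by lia.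
rewrite (big_pred1 (Ordinal hl)) // => -[v hv].
rewrite -[RHS]/(v == i.+1) /spider_adj /spider_adj0 /=; lia.
Qed.

(** The eigenvector equations at the centre, at the middle [i.+1] of leg i and at its end
    [i.+1 + q], legs being counted from 0. *)
Definition spider_eqs (R : pzRingType) (q : nat) (mu : R) (Y : nat -> R) : Prop :=
  [/\ q%:R * Y 0%N - \sum_(i < q) Y i.+1 = mu * Y 0%N,
      forall i, (i < q)%N -> 2 * Y i.+1 - (Y 0%N + Y (i.+1 + q)%N) = mu * Y i.+1
    & forall i, (i < q)%N -> Y (i.+1 + q)%N - Y i.+1 = mu * Y (i.+1 + q)%N].

Section Spider.

Variables (R : fieldType) (n q : nat) (adj : rel 'I_n) (mu : R).
Variable f : 'I_n -> 'I_n.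
Hypotheses (sg : simple_graph adj) (f_bij : bijective f) (nE : n = (q + q + 1)%N).
Hypothesis adjE : forall x y, adj x y = spider_adj q q (f x) (f y).

Lemma big_spider_adj (S : nmodType) (x : 'I_n -> S) (Y : nat -> S) u :
  (forall v, x v = Y (f v)) ->
  \sum_(v | adj u v) x v = \sum_(v < q + q + 1 | spider_adj q q (f u) v) Y v.
Proof.
move=> xY; rewrite (eq_bigl (fun v => spider_adj q q (f u) (f v))) //.
rewrite (eq_bigr (fun v => Y (f v))) //.
rewrite -(reindex f (P := fun v => spider_adj q q (f u) v) (F := fun v : 'I_n => Y v)).
  by move: (f u) => w; clear - nE; subst n.
exact: onW_bij.
Qed.

Lemma spider_surj k : (k < q + q + 1)%N -> exists u, nat_of_ord (f u) = k.
Proof.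
have [g fK gK] := f_bij => kq; have kn : (k < n)%N by rewrite nE.
by exists (g (Ordinal kn)); rewrite gK.
Qed.

Lemma spider_eigvecP (x : 'I_n -> R) (Y : nat -> R) : (forall v, x v = Y (f v)) ->
  lap_eigvec adj mu x <-> spider_eqs q mu Y.
Proof.
move=> xY.
(* A degree is the neighbour sum of the constant 1, so the same three formulas evaluate degrees
   too. *)
have degE u : (degree adj u)%:R = \sum_(v < q + q + 1 | spider_adj q q (f u) v) (1 : R).
  rewrite -(big_spider_adj (x := fun=> 1) (Y := fun=> 1)) // sumr_const.
  by rewrite /degree cardsE.
split=> [xE | [E0 E1 E2] u].
  have eqE k u : nat_of_ord (f u) = k ->
    (\sum_(v < q + q + 1 | spider_adj q q k v) (1 : R)) * Y k
      - \sum_(v < q + q + 1 | spider_adj q q k v) Y v = mu * Y k.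
    by move=> <-; have := xE u; rewrite xY degE (big_spider_adj _ xY).
  split.
  - have [|u fu] := @spider_surj 0; first by lia.
    have := eqE _ _ fu; rewrite (big_spider0 _ (fun=> 1)) big_spider0.
    by rewrite sumr_const card_ord.
  - move=> i iq; have [|u fu] := @spider_surj i.+1; first by lia.
    by have := eqE _ _ fu; rewrite (big_spider_mid (fun=> 1)) // big_spider_mid.
  - move=> i iq; have [|u fu] := @spider_surj (i.+1 + q); first by lia.
    have := eqE _ _ fu; rewrite (big_spider_leaf (fun=> 1)) // big_spider_leaf //.
    by rewrite mul1r.
rewrite xY degE (big_spider_adj _ xY).
have fn : (f u < q + q + 1)%N by have := ltn_ord (f u); lia.
move: (nat_of_ord (f u)) fn => [|k] kq.
  by rewrite (big_spider0 _ (fun=> 1)) big_spider0 sumr_const card_ord.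
have [iq | ik] := ltnP k q.
  by rewrite (big_spider_mid (fun=> 1)) // big_spider_mid //; exact: E1.
have [i iq ->] : exists2 i, (i < q)%N & k.+1 = (i.+1 + q)%N.
  by exists (k - q)%N; lia.
by rewrite (big_spider_leaf (fun=> 1)) // big_spider_leaf // mul1r; exact: E2.
Qed.

Lemma spider_extend (x : 'I_n -> R) : exists Y : nat -> R, forall v, x v = Y (f v).
Proof.
have [g fK gK] := f_bij.
exists (fun k => oapp (fun w => x (g w)) 0 (insub k)) => v.
by rewrite valK /= fK.
Qed.

Lemma spider_eqs_zero (Y : nat -> R) : mu ^+ 2 - 3 * mu + 1 != 0 ->
  spider_eqs q mu Y -> Y 0%N = 0 ->
  forall k, (k < q + q + 1)%N -> Y k = 0.
Proof.
move=> nz [E0 E1 E2] Y0.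
have Yl i : (i < q)%N -> Y (i.+1 + q)%N = 0 /\ Y i.+1 = 0.
  move=> iq; have e2 := E2 i iq; have e1 := E1 i iq.
  have a : Y i.+1 = (1 - mu) * Y (i.+1 + q)%N.
    by rewrite mulrBl mul1r -e2; ring.
  have : (mu ^+ 2 - 3 * mu + 1) * Y (i.+1 + q)%N = 0.
    rewrite Y0 a in e1; transitivity
      (2 * ((1 - mu) * Y (i.+1 + q)%N) - (0 + Y (i.+1 + q)%N)
        - mu * ((1 - mu) * Y (i.+1 + q)%N)); first by ring.
    by rewrite e1 subrr.
  move/eqP; rewrite mulf_eq0 (negbTE nz) /= => /eqP b.
  by rewrite a b mulr0.
move=> [|k] kq //; have [iq | ik] := ltnP k q; first by have [] := Yl k iq.
have -> : k.+1 = ((k - q).+1 + q)%N by lia.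
by have [|] := Yl (k - q)%N; first by lia.
Qed.

Lemma spider_mult_le1 : mu ^+ 2 - 3 * mu + 1 != 0 -> (lap_mult adj mu <= 1)%N.
Proof.
move=> nz; have [|c fc] := @spider_surj 0; first by lia.
rewrite -(cards1 c); apply: lap_mult_le => // x xE x0 u.
have [Y xY] := spider_extend x; rewrite xY.
apply: spider_eqs_zero => //; first exact/(spider_eigvecP xY).
  by rewrite -fc -xY x0 ?inE.
by have := ltn_ord (f u); lia.
Qed.

(* For each t, the eigenvector supported on legs 0 and t + 1, with opposite
   values on the two legs. *)
Lemma spider_mult_ge : mu ^+ 2 - 3 * mu + 1 = 0 -> (q.-1 <= lap_mult adj mu)%N.
Proof.
move=> mu0; have [g fK gK] := f_bij.
pose e (t k : nat) : R := (k == t.+2)%:R - (k == 1%N)%:R.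
(* With centre value 0, the middle equation makes the end value 2 - mu times the middle one; the end
   equation then amounts to mu^2 - 3 mu + 1 = 0. *)
pose Y t (k : nat) : R :=
  if k == 0%N then 0 else if (k <= q)%N then e t k else (2 - mu) * e t (k - q)%N.
(* At [t.+2], the middle of leg t + 1, only the eigenvector of index [t] is nonzero. *)
have pn (t : 'I_q.-1) : (t.+2 < n)%N by have := ltn_ord t; lia.
apply: (lap_mult_ge (x := fun (t : 'I_q.-1) u => Y t (f u))
  (p := fun t => g (Ordinal (pn t)))) => // [t | t s].
  have tq := ltn_ord t.
  apply/(@spider_eigvecP _ (Y t)) => //; split.
  - rewrite /Y /= !mulr0 sub0r; apply/eqP; rewrite oppr_eq0; apply/eqP.
    rewrite (eq_bigr (fun i : 'I_q => e t i.+1)); last by move=> i _; rewrite ltn_ord.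
    rewrite sumrB; apply/eqP; rewrite subr_eq0; apply/eqP.
    have h1 : (t.+1 < q)%N by lia.
    have h0 : (0 < q)%N by lia.
    rewrite (bigD1 (Ordinal h1)) //= eqxx big1 ?addr0; last first.
      by move=> i; rewrite -val_eqE /= eqSS => /negbTE ->.
    rewrite (bigD1 (Ordinal h0)) //= big1 ?addr0 //.
    by move=> i; rewrite -val_eqE /= eqSS => /negbTE ->.
  - move=> i iq; rewrite /Y /= iq addnK ifF; last by lia.
    by ring.
  - move=> i iq; rewrite /Y /= iq addnK ifF; last by lia.
    apply/eqP; rewrite -subr_eq0; apply/eqP.
    transitivity (- (mu ^+ 2 - 3 * mu + 1) * - e t i.+1); first by ring.
    by rewrite mu0; ring.
have sq := ltn_ord s.
rewrite gK /Y /= ifT; last by lia.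
by rewrite /e !eqSS subr0 eq_sym.
Qed.

(** When [D] is nonzero, each middle value is (1 - mu) / D times the nonzero centre value; the
    centre equation then becomes mu times the last quadratic equal to 0. *)
Lemma spider_eigenvalue : eigenvalue (laplacian R adj) mu ->
  [\/ mu = 0, mu ^+ 2 - 3 * mu + 1 = 0
    | mu ^+ 2 - (q%:R + 3) * mu + (2 * q%:R + 1) = 0].
Proof.
move=> /eigenvalueP [v /(lap_eigvecP _ _ sg) vE v0].
have [Y xY] := spider_extend (v 0).
have [nz | ] := eqVneq (mu ^+ 2 - 3 * mu + 1) 0; first by constructor 2.
set D := (X in X != 0) => nz.
have YE := (spider_eigvecP xY).1 vE; have [E0 E1 E2] := YE.
have Y0 : Y 0%N != 0.
  apply: contraNneq v0 => Y0; apply/eqP/rowP => u; rewrite mxE xY.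
  apply: spider_eqs_zero YE Y0 _ _ => //; by have := ltn_ord (f u); lia.
have mid i : (i < q)%N -> D * Y i.+1 = (1 - mu) * Y 0%N.
  move=> iq; have e1 := E1 i iq; have e2 := E2 i iq.
  have -> : Y 0%N = 2 * Y i.+1 - Y (i.+1 + q)%N - mu * Y i.+1 by rewrite -e1; ring.
  have -> : Y i.+1 = Y (i.+1 + q)%N - mu * Y (i.+1 + q)%N by rewrite -e2; ring.
  by rewrite /D; ring.
have S : D * \sum_(i < q) Y i.+1 = q%:R * ((1 - mu) * Y 0%N).
  rewrite mulr_sumr (eq_bigr (fun=> (1 - mu) * Y 0%N)); last by move=> i _; exact: mid.
  by rewrite sumr_const card_ord mulr_natl.
have : mu * (mu ^+ 2 - (q%:R + 3) * mu + (2 * q%:R + 1)) * Y 0%N = 0.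
  have -> : mu * (mu ^+ 2 - (q%:R + 3) * mu + (2 * q%:R + 1)) * Y 0%N =
     - (D * (q%:R * Y 0%N - mu * Y 0%N) - q%:R * ((1 - mu) * Y 0%N)).
    by rewrite /D; ring.
  rewrite -S -mulrBr -E0; ring.
move/eqP; rewrite !mulf_eq0 (negbTE Y0) orbF => /orP [] /eqP ->.
  by constructor 1.
by constructor 3.
Qed.

End Spider.

(** * Algebraic against geometric multiplicity for symmetric matrices *)

Lemma char_poly_similar (R : comUnitRingType) n (P A : 'M[R]_n) :
  P \in unitmx -> char_poly (invmx P *m A *m P) = char_poly A.
Proof.
move=> Pu; rewrite /char_poly /char_poly_mx.
have -> : 'X%:M - map_mx polyC (invmx P *m A *m P)
    = map_mx polyC (invmx P) *m ('X%:M - map_mx polyC A) *m map_mx polyC P.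
  rewrite mulmxBr mulmxBl !map_mxM; congr (_ - _).
  by rewrite mul_mx_scalar -scalemxAl -map_mxM mulVmx // map_mx1 scalemx1.
rewrite !det_mulmx mulrAC -det_mulmx -map_mxM mulVmx // map_mx1 det1 mul1r.
by [].
Qed.

Lemma char_poly_diag (R : comNzRingType) n (d : 'rV[R]_n) :
  char_poly (diag_mx d) = \prod_(i < n) ('X - (d 0 i)%:P).
Proof.
rewrite char_poly_trig ?diag_mx_is_trig //.
by apply: eq_bigr => i _; rewrite mxE eqxx mulr1n.
Qed.

(** [s] lists the diagonal entries up to order, and the rows of [P] at entries equal to [a] are
    independent eigenvectors. *)
Lemma count_spectrum_diag (F : fieldType) n (P : 'M[F]_n) (d : 'rV[F]_n) s a :
  P \in unitmx ->
  char_poly (invmx P *m diag_mx d *m P) = \prod_(x <- s) ('X - x%:P) ->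
  (count_mem a s <= \rank (eigenspace (invmx P *m diag_mx d *m P) a))%N.
Proof.
move=> Pu; rewrite char_poly_similar // char_poly_diag => e.
have : perm_eq (codom (d 0)) s.
  by apply: prod_XsubC_eq; rewrite -e /codom big_image.
move/permP/(_ (pred1 a)) <-.
pose J := [set i | d 0 i == a].
have -> : count_mem a (codom (d 0)) = #|J|.
  rewrite -sum1_count big_map big_enum_cond -sum1_card.
  by rewrite (eq_bigl [in J]) // => i; rewrite /= inE.
pose f (i : 'I_#|J|) := enum_val i.
pose B : 'M_(#|J|, n) := \matrix_(i, j) P (f i) j.
pose C : 'M_(n, #|J|) := \matrix_(i, j) invmx P i (f j).
have BC : B *m C = 1%:M.
  apply/matrixP => i j; have := congr1 (fun A : 'M_n => A (f i) (f j)) (mulmxV Pu).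
  rewrite !mxE /= (inj_eq enum_val_inj) => <-.
  by apply: eq_bigr => k _; rewrite !mxE.
have {1}<- : \rank B = #|J|.
  by apply/eqP; rewrite eqn_leq rank_leq_row /= -{1}(mxrank1 F #|J|) -BC mxrankM_maxl.
apply: mxrankS; apply/row_subP => i; apply/eigenspaceP.
have -> : row i B = row (f i) P by apply/rowP => j; rewrite !mxE.
rewrite -row_mul !mulmxA mulmxV // mul1mx.
have : f i \in J by exact: enum_valP.
by rewrite inE mul_diag_mx => /eqP fi; apply/rowP => j; rewrite !mxE fi.
Qed.

(** Over the complex numbers a real symmetric matrix is normal, hence diagonalizable; counts and
    ranks survive the field extension. *)
Lemma symmetric_count_spectrum (R : rcfType) n (A : 'M[R]_n) s a :
  A^T = A -> char_poly A = \prod_(x <- s) ('X - x%:P) ->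
  (count_mem a s <= \rank (eigenspace A a))%N.
Proof.
move=> sA cA; pose B := map_mx (real_complex R) A.
have nB : B \is normalmx.
  apply: symmetric_normalmx.
    by apply/is_hermitianmxP/matrixP => i j; rewrite expr0 scale1r !mxE -{1}sA mxE.
  by apply/mxOverP => i j; rewrite mxE complex_real.
have /orthomx_spectralP BE := nB; have Pu := spectral_unit B.
rewrite -(mxrank_map (real_complex R)) map_eigenspace -/B [B in eigenspace B]BE.
have -> : count_mem a s = count_mem (real_complex R a) (map (real_complex R) s).
  by rewrite count_map; apply: eq_count => x /=; rewrite (inj_eq (fmorph_inj _)).
apply: count_spectrum_diag => //.
by rewrite -BE /B -map_char_poly cA map_prod_XsubC big_map.
Qed.

Lemma tr_laplacian (R : pzRingType) n (adj : rel 'I_n) : simple_graph adj ->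
  (laplacian R adj)^T = laplacian R adj.
Proof.
move=> [sym _]; apply/matrixP => i j; rewrite !mxE eq_sym sym.
by case: eqP => [->|].
Qed.

Lemma map_laplacian (R : fieldType) (S : unitRingType) (f : {rmorphism R -> S}) n
    (adj : rel 'I_n) : map_mx f (laplacian R adj) = laplacian S adj.
Proof.
apply/matrixP => i j; rewrite !mxE; case: ifP => _; first by rewrite rmorph_nat.
by case: ifP => _; rewrite ?rmorphN ?rmorph1 ?rmorph0.
Qed.

Lemma lap_eigenvalue_mult (R : fieldType) n (adj : rel 'I_n) (mu : R) :
  eigenvalue (laplacian R adj) mu = (0 < lap_mult adj mu)%N.
Proof. by rewrite /lap_mult lt0n mxrank_eq0. Qed.

Lemma lap_mult0_gt0 (R : fieldType) n (adj : rel 'I_n) :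
  simple_graph adj -> (0 < n)%N -> (0 < lap_mult adj (0 : R))%N.
Proof.
move=> sg n0; apply: (@lap_mult_ge _ _ _ _ 1 (fun _ _ => 1) (fun=> Ordinal n0)) => //.
  by move=> _ u; rewrite sumr_const mulr1 mul0r /degree cardsE subrr.
by move=> t s; rewrite !ord1 eqxx.
Qed.

(** * The polynomial x^2 - 3 x + 1 and conjugate eigenvalues *)

(** For x = a / b in lowest terms, a and b are not both even, so a^2 - 3 a b + b^2 is odd. *)
Lemma golden_poly_no_rat_root (x : rat) : x ^+ 2 - 3 * x + 1 != 0.
Proof.
apply/negP => /eqP e.
have b0 : (denq x)%:~R != 0 :> rat by rewrite intr_eq0 denq_neq0.
have eq0 : (numq x) ^+ 2 - 3 * numq x * denq x + (denq x) ^+ 2 = 0.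
  apply: (@intr_inj rat); rewrite !(rmorphD, rmorphB, rmorphXn, rmorphM) /=.
  have xE : (numq x)%:~R = x * (denq x)%:~R.
    by rewrite -{2}(divq_num_den x) divfK.
  rewrite rmorphN !rmorphM rmorph_nat rmorph0 /= !xE.
  transitivity ((x ^+ 2 - 3 * x + 1) * (denq x)%:~R ^+ 2); first by ring.
  by rewrite e mul0r.
have := coprime_num_den x; move: (numq x) (denq x) eq0 => a b eq0 co.
have [k ak] : exists k, a = 2 * k \/ a = 2 * k + 1.
  by exists (a %/ 2)%Z; have := divz_eq a 2; have := modz_ge0 a (isT : (2 : int) != 0);
     have := ltz_pmod a (isT : 0 < (2 : int)); lia.
have [l bl] : exists l, b = 2 * l \/ b = 2 * l + 1.
  by exists (b %/ 2)%Z; have := divz_eq b 2; have := modz_ge0 b (isT : (2 : int) != 0);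
     have := ltz_pmod b (isT : 0 < (2 : int)); lia.
case: ak => ak; case: bl => bl; subst a b.
- by move: co; rewrite !abszM /coprime -muln_gcdr muln_eq1.
all: by move: eq0; rewrite !expr2; lia.
Qed.

Lemma golden_conjugates (R : realType) n (adj : rel 'I_n) (a b : R) :
  eigenvalue (laplacian R adj) a ->
  a ^+ 2 - 3 * a + 1 = 0 -> b ^+ 2 - 3 * b + 1 = 0 -> lap_conjugates adj a b.
Proof.
rewrite eigenvalue_root_char => ra a0 b0.
pose p : {poly rat} := 'X ^+ 2 + ((- 3) *: 'X + 1%:P).
have ps : size p = 3%N.
  rewrite size_polyDl size_polyXn //.
  apply: leq_ltn_trans (size_polyD _ _) _.
  by rewrite gtn_max (leq_ltn_trans (size_scale_leq _ _)) ?size_polyX // size_poly1.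
have mp (x : R) : (map_poly ratr p).[x] = x ^+ 2 - 3 * x + 1.
  rewrite /p rmorphD rmorphD /= map_polyXn map_polyZ map_polyX map_polyC /=.
  by rewrite !hornerE rmorphN rmorph_nat rmorph1 /=; ring.
(* Having degree 2, [p] is irreducible once it has no rational root. *)
have irr : irreducible_poly p.
  apply: cubic_irreducible; first by rewrite ps.
  by move=> x; rewrite /root /p !hornerE mulNr; exact: golden_poly_no_rat_root.
have rpa : root (map_poly ratr p) a by rewrite /root mp a0.
exists p; split=> //; last by rewrite /root mp b0.
(* Coprimality over the rationals would persist over [R], against the common root [a]; so the
   irreducible [p] divides the characteristic polynomial. *)
have [cop | ncop] := boolP (coprimep p (char_poly (laplacian rat adj))).
  move: cop; rewrite -(coprimep_map (ratr : {rmorphism rat -> R})) => cop.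
  by have := coprimep_root cop rpa; rewrite map_char_poly map_laplacian (eqP ra) eqxx.
have [_ irr2] := irr.
have g := irr2 _ ncop (dvdp_gcdl _ _).
by rewrite -(eqp_dvdl _ g) dvdp_gcdr.
Qed.

(** * The algebraic connectivity of the spider *)

Section GoldenRatio.

Variable R : realType.

Let s5 : (Num.sqrt 5 : R) ^+ 2 = 5. Proof. by rewrite sqr_sqrtr. Qed.
Let s5_ge0 : 0 <= (Num.sqrt 5 : R). Proof. exact: sqrtr_ge0. Qed.

Lemma golden_roots (mu : R) : mu ^+ 2 - 3 * mu + 1 = 0 <->
  mu = (3 + Num.sqrt 5) / 2 \/ mu = (3 - Num.sqrt 5) / 2.
Proof.
have e : mu ^+ 2 - 3 * mu + 1 =
    (mu - (3 + Num.sqrt 5) / 2) * (mu - (3 - Num.sqrt 5) / 2).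
  have -> : (mu - (3 + Num.sqrt 5) / 2) * (mu - (3 - Num.sqrt 5) / 2) =
     mu ^+ 2 - 3 * mu + (9 - (Num.sqrt 5 : R) ^+ 2) / 4 by field.
  by rewrite s5; field.
rewrite e; split=> [/eqP | [->|->]]; last 2 first.
- by rewrite subrr mul0r.
- by rewrite subrr mulr0.
by rewrite mulf_eq0 !subr_eq0 => /orP [] /eqP; [left | right].
Qed.

(** 0 occurs exactly once in [s], and (3 - sqrt 5) / 2 occurs and is a lower bound for all other
    entries, so it has index 1. *)
Lemma spider_second_eigenvalue n (adj : rel 'I_n) q (s : seq R) :
  is_tree adj -> (2 < q)%N -> iso_spider adj q q -> lap_spectrum adj s ->
  s`_1 = (3 - Num.sqrt 5) / 2.
Proof.
move=> [sg _ _] q2 [_ nE [f [fb adjE]]] [srt chr].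
set th := (3 - Num.sqrt 5) / 2.
have th_bd : 0 < th < 1.
  by rewrite /th; move: s5 s5_ge0; set r := Num.sqrt _ => h1 h2; apply/andP; split; nra.
have th0 : th ^+ 2 - 3 * th + 1 = 0 by apply/golden_roots; right.
have memE x : (x \in s) = eigenvalue (laplacian R adj) x.
  by rewrite eigenvalue_root_char chr root_prod_XsubC.
have s_th : th \in s.
  rewrite memE lap_eigenvalue_mult.
  by apply: leq_trans (spider_mult_ge sg fb nE adjE th0); lia.
have s_0 : 0 \in s.
  by rewrite memE lap_eigenvalue_mult; apply: lap_mult0_gt0 => //; lia.
have s_cases x : x \in s -> x = 0 \/ th <= x.
  rewrite memE => /(spider_eigenvalue sg fb nE adjE) [-> | /golden_roots [->|->] | e].
  - by left.
  - by right; rewrite /th; have := s5_ge0; set r := Num.sqrt _ => h; lra.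
  - by right.
  (* x^2 - (q + 3) x + 2 q + 1 = (1 - x) (q + 2 - x) + (q - 1) is positive for x < 1. *)
  right; rewrite leNgt; apply/negP => x_th.
  have q1 : 1 < q%:R :> R by rewrite ltr1n; lia.
  have x1 : x < 1 by case/andP: th_bd => _; apply: lt_trans.
  move: q1 e; move: (q%:R) => a q1 e; clear - q1 x1 e; nra.
(* [s] counts algebraic multiplicity; symmetry of the Laplacian bounds it by the dimension of the
   eigenspace. *)
have c0 : (count_mem (0%R : R) s <= 1)%N.
  apply: leq_trans (symmetric_count_spectrum _ (tr_laplacian _ sg) chr) _.
  apply: (spider_mult_le1 sg fb nE adjE).
  by rewrite expr0n /= mulr0 subr0 add0r oner_eq0.
have sz : size s = n.
  by have := size_char_poly (laplacian R adj); rewrite chr size_prod_XsubC => -[].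
case: s srt sz s_th s_0 s_cases c0 {chr memE} => [|a [|b t]] //=; try lia.
move=> /andP [ab srt] _ s_th s_0 s_cases c0.
case/andP: th_bd => th_gt0 th_lt1.
have a_min x : x \in [:: a, b & t] -> a <= x.
  rewrite inE => /orP [/eqP -> // | xt].
  have : path <=%R a (b :: t) by rewrite /= ab srt.
  by move/(order_path_min le_trans)/allP; apply.
have a0 : a = 0.
  have := a_min 0 s_0; have [|//|] := s_cases a; first by rewrite inE eqxx.
  by move=> h1 h2; lra.
have b_min x : x \in b :: t -> b <= x.
  rewrite inE => /orP [/eqP -> // | xt].
  by move/(order_path_min le_trans)/allP: srt; apply.
have s_th' : th \in b :: t.
  move: s_th; rewrite inE => /orP [/eqP e|//].
  by move: th_gt0; rewrite e a0 ltxx.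
have bs : b \in [:: a, b & t] by rewrite !inE eqxx orbT.
have [e | th_b] := s_cases b bs.
  by move: c0; rewrite a0 e eqxx.
by apply/eqP; rewrite eq_le th_b b_min.
Qed.

End GoldenRatio.

(** * The bound, its equality case and the algebraic connectivity *)

(** The bound is doubled to stay in the natural numbers; by [6 <= n] the subtraction is not
    truncated. *)
Theorem theorem4p1 (R : realType) (n : nat) (adj : rel 'I_n) (mu : R) :
  is_tree adj -> (6 <= n)%N ->
  eigenvalue (laplacian R adj) mu -> mu != 1 ->
  [/\ (2 * lap_mult adj mu <= n - 3)%N,
      (2 * lap_mult adj mu = n - 3)%N <->
        (iso_spider adj (n.-1./2) (n.-1./2) /\
         (mu = (3 + Num.sqrt 5) / 2 \/ mu = (3 - Num.sqrt 5) / 2))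
    & (2 * lap_mult adj mu = n - 3)%N ->
        forall s : seq R, lap_spectrum adj s ->
          mu = s`_1 \/ lap_conjugates adj mu s`_1].
Proof.
move=> tree n6 ev mu1; have [sg _ _] := tree.
(* Reaching n - 3 forces n = 2q + 1 and m = q - 1, hence equality; the bound follows. *)
have extremal : (n - 3 <= 2 * lap_mult adj mu)%N -> (2 * lap_mult adj mu = n - 3)%N.
  by case/(extremal_structure tree n6 mu1) => w [nE mE _ _ _]; lia.
have bound : (2 * lap_mult adj mu <= n - 3)%N.
  by case: (leqP (n - 3) (2 * lap_mult adj mu)) => [/extremal -> //|/ltnW].
have spider : (2 * lap_mult adj mu = n - 3)%N ->
    iso_spider adj n.-1./2 n.-1./2 /\ mu ^+ 2 - 3 * mu + 1 = 0.
  move=> e; have iso : iso_spider adj n.-1./2 n.-1./2.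
    by apply: (extremal_spider tree n6 mu1); rewrite e.
  split=> //; have [_ nE [f [fb adjE]]] := iso.
  (* Otherwise m <= 1, while 2m = n - 3 >= 3. *)
  apply/eqP/negPn/negP => nz; have := spider_mult_le1 sg fb nE adjE nz.
  by clear - e n6; lia.
split=> //; [split | ].
- by case/spider => iso /golden_roots.
- move=> [[_ nE [f [fb adjE]]] /golden_roots mu0]; apply: extremal.
  have := spider_mult_ge sg fb nE adjE mu0; by clear - nE; lia.
move=> /spider [iso mu0] s spec.
have q2 : (2 < n.-1./2)%N by have [_ nE _] := iso; clear - nE n6; lia.
(* The algebraic connectivity is the smaller root, so [mu] is either equal to it or the other root,
   its conjugate. *)
rewrite (spider_second_eigenvalue tree q2 iso spec).
case/golden_roots: (mu0) => muE; last by left.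
by right; apply: (golden_conjugates ev mu0); apply/golden_roots; right.
Qed.
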